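(* There is a finite lattice on which the toggle game cannot be won, i.e. a finite lattice that has no winning toggle sequence. Consequently the NCI conjecture fails if only left-linear trees are allowed: it is not true that for every finite lattice $P$ the set $S_\top$ is the value of a left-linear dot-algebra tree over the non-cancelling elements of $P$.
   Context: All lattices are finite; $\top$ denotes the greatest element. For a finite lattice $P$ the Möbius values are defined by $\mu(\top)=1$ and $\mu(v)=-\sum_{u>v}\mu(u)$ for $v\neq\top$. The descendants of $v$ are the elements $x<v$. Toggle game. A toggle sequence for $P$ is defined inductively: the empty sequence is a toggle sequence; if $v_1,\dots,v_n$ is a toggle sequence, then $v_{n+1}\in P\setminus\{\top\}$ may be appended if and only if $\mu(v_{n+1})\neq 0$ and $v_{n+1}$ and all its descendants have the same toggle parity, where the toggle parity of $v$ after $n$ moves is $\pi_n(v)=|\{i\in\{1,\dots,n\}: v\le v_i\}| \bmod 2$. The state after $n$ moves is $T_n=\{v\in P:\pi_n(v)=1\}$. The sequence is winning if $T_n=P\setminus\{\top\}$. The toggle game on $P$ can be won if a winning toggle sequence exists. Dot-algebra and NCI conjecture. For $v\in P$, $v\neq\top$, let $S_v=\{x\in P: x\le v\}$, and let $S_\top=\bigcup_{v\ne\top}S_v$. The non-cancelling elements are the $v\neq\top$ with $\mu(v)\ne0$. A dot-algebra tree is a binary tree whose leaves are labelled by sets $S_v$ with $v$ non-cancelling (or by $\emptyset$), and whose internal nodes are labelled by one of two partial operations: disjoint union $A\mathbin{\dot\cup}B$ (defined as $A\cup B$, only when $A\cap B=\emptyset$) and subset complement $A\mathbin{\dot\setminus}B$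 (defined as $A\setminus B$, only when $B\subseteq A$), applied to the value $A$ of the left child and the value $B$ of the right child; every operation in the tree has to be defined. The tree is left-linear if every right child is a leaf. The NCI (Non-Cancelling Intersections) conjecture asserts that for every finite lattice $P$ the set $S_\top$ is the value of some dot-algebra tree; its left-linear form requires the tree to be left-linear. *)

(* Defs.v *)
From HB Require Import structures.
From mathcomp Require Import all_boot all_order all_algebra.

Set Implicit Arguments.
Unset Strict Implicit.
Unset Printing Implicit Defensive.

Import Order.TTheory GRing.Theory.

Local Open Scope order_scope.

(* A finite lattice with a greatest element is a [finTBLatticeType]: for a
   finite lattice, having top and bottom just means being nonempty. *)

Section Mobius.
Context {d : Order.disp_t} {P : finTBLatticeType d}.
Implicit Types u v : P.

(* The recursion goes up in the order; [n] is fuel, and the number of elements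
   of [P] is enough of it (see [mobius_top] and [mobius_lt_top]). *)
Fixpoint mobius_rec (n : nat) (v : P) : int :=
  if v == \top then 1%R
  else if n is n'.+1 then (- \sum_(u : P | (v < u)%O) mobius_rec n' u)%R
  else 0%R.

Definition mobius (v : P) : int := mobius_rec #|P| v.

Lemma mobius_rec_fuel m n v :
  (#|[set u | (v < u)%O]| <= m)%N -> (#|[set u | (v < u)%O]| <= n)%N ->
  mobius_rec m v = mobius_rec n v.
Proof.
elim: m n v => [|m IHm] [|n] v //=; case: eqVneq => // vNtop.
- have top_gt : \top \in [set u | v < u] by rewrite inE lt_def eq_sym vNtop lex1.
  by rewrite leqn0 cards_eq0 => /eqP E; rewrite E inE in top_gt.
- have top_gt : \top \in [set u | v < u] by rewrite inE lt_def eq_sym vNtop lex1.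
  by move=> _; rewrite leqn0 cards_eq0 => /eqP E; rewrite E inE in top_gt.
- move=> le_m le_n; congr (- _)%R; apply: eq_bigr => u lt_vu.
  have lt_card : (#|[set w | (u < w)%O]| < #|[set w | (v < w)%O]|)%N.
    apply: proper_card; apply/properP; split.
      by apply/subsetP => w; rewrite !inE; apply: lt_trans.
    by exists u; rewrite !inE ?ltxx.
  by apply: IHm; rewrite -ltnS (leq_trans lt_card).
Qed.

Lemma mobius_top : mobius \top = 1%R.
Proof. by rewrite /mobius; case: #|P| => [|n] /=; rewrite eqxx. Qed.

Lemma mobius_lt_top v :
  v != \top -> mobius v = (- \sum_(u : P | (v < u)%O) mobius u)%R.
Proof.
move=> vNtop; rewrite /mobius.
rewrite (@mobius_rec_fuel #|P| #|P|.+1) ?max_card //; first by rewrite /= (negPf vNtop).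
by rewrite (leq_trans (max_card _)).
Qed.

End Mobius.

Section ToggleGame.
Context {d : Order.disp_t} {P : finTBLatticeType d}.

(* The sequence [:: v_1; ...; v_n] lists the moves in chronological order. *)
Definition toggle_parity (s : seq P) (v : P) : bool :=
  odd (count (fun w => v <= w) s).

Inductive toggle_sequence : seq P -> Prop :=
| toggle_nil : toggle_sequence [::]
| toggle_rcons (s : seq P) (v : P) :
    toggle_sequence s ->
    v != \top ->
    mobius v != 0%R ->
    (forall x, x < v -> toggle_parity s x = toggle_parity s v) ->
    toggle_sequence (rcons s v).

Definition toggle_state (s : seq P) : {set P} := [set v | toggle_parity s v].

Definition winning (s : seq P) : Prop :=
  toggle_sequence s /\ toggle_state s = [set: P] :\ \top.

End ToggleGame.

Definition toggle_game_can_be_won (d : Order.disp_t) (P : finTBLatticeType d) :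
  Prop := exists s : seq P, winning s.

Section DotAlgebra.
Context {d : Order.disp_t} {P : finTBLatticeType d}.

Definition down_set (v : P) : {set P} := [set x | x <= v].

(* [S_v]; the top element is exceptional: [S_top] is the union of the others. *)
Definition S_ (v : P) : {set P} :=
  if v == \top then \bigcup_(w : P | w != \top) down_set w else down_set v.

Definition non_cancelling (v : P) : bool := (v != \top) && (mobius v != 0%R).

Inductive dot_tree : Type :=
| DotEmpty
| DotLeaf (v : P) of non_cancelling v
| DotUnion (l r : dot_tree)
| DotDiff (l r : dot_tree).

(* [None] when some operation in the tree is not defined. *)
Fixpoint dot_value (t : dot_tree) : option {set P} :=
  match t with
  | DotEmpty => Some set0
  | DotLeaf v _ => Some (S_ v)
  | DotUnion l r =>
      if (dot_value l, dot_value r) is (Some A, Some B) then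
        if A :&: B == set0 then Some (A :|: B) else None
      else None
  | DotDiff l r =>
      if (dot_value l, dot_value r) is (Some A, Some B) then
        if B \subset A then Some (A :\: B) else None
      else None
  end.

Definition is_leaf (t : dot_tree) : bool :=
  match t with DotEmpty | DotLeaf _ _ => true | _ => false end.

Fixpoint left_linear (t : dot_tree) : bool :=
  match t with
  | DotEmpty | DotLeaf _ _ => true
  | DotUnion l r | DotDiff l r => left_linear l && is_leaf r
  end.

End DotAlgebra.

Arguments dot_tree {d} P.

Definition left_linear_NCI : Prop :=
  forall (d : Order.disp_t) (P : finTBLatticeType d),
    exists t : dot_tree P, left_linear t /\ dot_value t = Some (S_ (\top : P)).

(* Main.v *)
Require Import Defs.
From HB Require Import structures.
From mathcomp Require Import all_boot all_order all_algebra.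

Set Implicit Arguments.
Unset Strict Implicit.
Unset Printing Implicit Defensive.

Import Order.TTheory GRing.Theory.

Local Open Scope order_scope.

(** The toggle game is a bandwidth game in disguise.  Let [G] be a finite graph
    without triangles and without 4-cycles.  Call a set of vertices a star when
    it consists of a vertex and some of its neighbours; the empty set, the whole
    vertex set and the stars are closed under intersection, so they form a
    lattice under reverse inclusion, with the empty set on top.  Its coatoms are
    the vertices of [G].  The Moebius function is -1 at a vertex, +1 at an edge,
    and 0 at every star with at least two leaves ([mobius_star]).  Apart from
    the bottom element, which influences only its own state, the moves are thus
    the vertices and the edges, but the cancelling paths [y - x - z] restrict
    them.

    Say that [x] deviates towards its neighbour [y] when the edge [xy] and the
    vertex [x] are in different states.  The state of a path [y - x - z] is the
    sum of the states of [xy], [xz] and [x], and a move that changes whether [x]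
    deviates towards [y] needs the path and the edge [xy] to agree; hence [x]
    does not deviate towards [z] then.  So a vertex deviates towards at most one
    neighbour at any time ([dev_unique]).  An edge with exactly one end on has
    exactly one end that deviates towards the other.  Therefore the set [U] of
    the vertices that are on always satisfies: the number of edges leaving [U]
    is at most the number of vertices ([toggle_cut]).

    On the other hand a move changes the state of at most one vertex, so a
    winning sequence passes through sets [U] of every size, even when one
    measures the size inside a prescribed set of vertices.  A graph in which
    every set of some intermediate size has a large edge boundary is therefore
    unwinnable ([wide_cut_unwinnable]).  The point-line incidence graph of the
    affine plane over a field with 11 elements is such a graph: a pair formed by
    a point that is on and a point that is off, on a common line, forces an edge
    of the boundary on that line ([incidence_cut]).

    A left-linear tree is a toggle sequence read from its leftmost leaf to its
    root, a union toggling a down-set on and a difference toggling it off.  So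
    an unwinnable lattice also refutes the left-linear conjecture. *)

(** * From left-linear trees to toggle sequences *)

Lemma toggle_parity_rcons (d : Order.disp_t) (P : finTBLatticeType d)
    (s : seq P) (w x : P) :
  toggle_parity (rcons s w) x = toggle_parity s x (+) (x <= w).
Proof. by rewrite /toggle_parity -cats1 count_cat oddD /= addn0 oddb. Qed.

Section LeftLinear.
Context {d : Order.disp_t} {P : finTBLatticeType d}.

Lemma S_top : S_ (\top : P) = [set: P] :\ \top.
Proof.
rewrite /S_ eqxx; apply/setP => x; rewrite !inE andbT.
apply/bigcupP/idP => [[w wNtop]|xNtop]; last by exists x; rewrite ?inE.
by rewrite inE; apply: contraTneq => ->; rewrite le1x.
Qed.

Lemma toggle_state_rcons (s : seq P) (w : P) (A : {set P}) :
  toggle_state s = A -> toggle_state (rcons s w) = [set x | (x \in A) (+) (x <= w)].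
Proof. by move=> <-; apply/setP => x; rewrite !inE toggle_parity_rcons. Qed.

(** Disjointness of [A] and [S_v], or inclusion of [S_v] in [A], says exactly
    that the down-set of [v] has a uniform toggle parity, which is what makes
    [v] a legal move in the state [A]. *)
Lemma left_linear_toggle (t : dot_tree P) (A : {set P}) :
  left_linear t -> dot_value t = Some A ->
  exists2 s, toggle_sequence s & toggle_state s = A.
Proof.
have step (s : seq P) (B : {set P}) (v : P) (b : bool) :
    toggle_sequence s -> toggle_state s = B -> non_cancelling v ->
    (forall x, x <= v -> (x \in B) = b) ->
    exists2 s', toggle_sequence s' &
      toggle_state s' = [set x | (x \in B) (+) (x <= v)].
  move=> sP sB /andP[vNtop mu_v] vB; exists (rcons s v).
    apply: toggle_rcons => // x /ltW xv.
    have E y : toggle_parity s y = (y \in B) by rewrite -sB inE.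
    by rewrite !E !vB.
  exact: toggle_state_rcons.
have nil0 : exists2 s, toggle_sequence s & toggle_state s = (set0 : {set P}).
  by exists [::]; [exact: toggle_nil|apply/setP => x; rewrite !inE].
have S_nc v : non_cancelling v -> S_ v = down_set v.
  by case/andP => /negPf vNtop _; rewrite /S_ vNtop.
elim: t A => [|v v_nc|l IHl r _|l IHl r _] A /=.
- by move=> _ [<-].
- move=> _ [<-]; case: nil0 => s sP s0.
  case: (step s set0 v false) => // [x _|s' s'P s'E]; first by rewrite inE.
  by exists s' => //; rewrite s'E S_nc //; apply/setP => x; rewrite !inE.
- case/andP=> l_lin r_leaf.
  case El: (dot_value l) => [B|//]; case Er: (dot_value r) => [C|//].
  case: ifP => // /eqP BC0 [<-]; have [s sP sB] := IHl _ l_lin El.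
  case: r r_leaf Er => //= [_ [<-]|v v_nc _ [EC]].
    by exists s; rewrite ?setU0.
  rewrite S_nc // in EC; rewrite -EC in BC0 *.
  have disj x : x <= v -> (x \in B) = false.
    by move=> xv; move/setP/(_ x): BC0; rewrite !inE xv andbT.
  have [s' s'P s'E] := step s B v false sP sB v_nc disj.
  exists s' => //; rewrite s'E; apply/setP => x; rewrite !inE.
  by case: (boolP (x <= v)) => [/disj ->|_]; rewrite ?orbF ?addbF.
- case/andP=> l_lin r_leaf.
  case El: (dot_value l) => [B|//]; case Er: (dot_value r) => [C|//].
  case: ifP => // CB [<-]; have [s sP sB] := IHl _ l_lin El.
  case: r r_leaf Er => //= [_ [<-]|v v_nc _ [EC]].
    by exists s; rewrite ?setD0.
  rewrite S_nc // in EC; rewrite -EC in CB *.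
  have sub x : x <= v -> (x \in B) = true.
    by move=> xv; apply: (subsetP CB); rewrite inE.
  have [s' s'P s'E] := step s B v true sP sB v_nc sub.
  exists s' => //; rewrite s'E; apply/setP => x; rewrite !inE.
  by case: (boolP (x <= v)) => [/sub ->|_]; rewrite ?addbF.
Qed.

End LeftLinear.

Lemma left_linear_NCI_winnable (d : Order.disp_t) (P : finTBLatticeType d) :
  left_linear_NCI -> toggle_game_can_be_won P.
Proof.
move=> /(_ d P)[t [t_lin]]; rewrite S_top => /(left_linear_toggle t_lin)[s sP sE].
by exists s.
Qed.

(** * The lattice of a closure system *)

Record closure_system (V : finType) := ClosureSystem {
  closed_set :> pred {set V};
  closed_setT : closed_set setT;
  closed_setI : forall A B, closed_set A -> closed_set B -> closed_set (A :&: B)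
}.

(** An alias of the subtype, so that it can carry the order by reverse
    inclusion: down-sets of the lattice are then the closed supersets of a
    closed set, and the smallest closed set is on top. *)
Definition closed_sets (V : finType) (C : closure_system V) : Type :=
  {A : {set V} | C A}.

Fact closed_sets_display : Order.disp_t. Proof. exact: Order.Disp tt tt. Qed.

Section ClosedSets.
Context {V : finType} (C : closure_system V).
Implicit Types A B : closed_sets C.

HB.instance Definition _ := SubFinite.on (closed_sets C).

Definition closure (A : {set V}) : {set V} :=
  \bigcap_(B : {set V} | C B && (A \subset B)) B.

Lemma closure_closed (A : {set V}) : C (closure A).
Proof.
apply: (big_ind (closed_set C)) => [||B /andP[]//]; first exact: closed_setT.
exact: closed_setI.
Qed.

Lemma closure_min (A B : {set V}) : C B -> (closure A \subset B) = (A \subset B).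
Proof.
move=> CB; apply/idP/idP => [|sAB]; last by apply: bigcap_inf; rewrite CB.
by apply: subset_trans; apply/bigcapsP => D /andP[].
Qed.

Definition closed_le A B := val B \subset val A.

Fact closed_le_refl : reflexive closed_le. Proof. by move=> A; apply: subxx. Qed.
Fact closed_le_anti : antisymmetric closed_le.
Proof.
by move=> A B sAB; apply: val_inj; apply/eqP; rewrite eqEsubset andbC.
Qed.
Fact closed_le_trans : transitive closed_le.
Proof. by move=> B A D sBA sDB; apply: subset_trans sDB sBA. Qed.

HB.instance Definition _ := Order.Le_isPOrder.Build closed_sets_display
  (closed_sets C) closed_le_refl closed_le_anti closed_le_trans.

Lemma closed_leE A B : (A <= B) = (val B \subset val A). Proof. by []. Qed.

Definition closed_meet A B : closed_sets C :=
  Sub _ (closure_closed (val A :|: val B)).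
Definition closed_join A B : closed_sets C :=
  Sub _ (closed_setI (valP A) (valP B)).

Fact closed_lexI A B D : (A <= closed_meet B D) = (A <= B) && (A <= D).
Proof. by rewrite !closed_leE closure_min ?subUset // (valP A). Qed.
Fact closed_leUx A B D : (closed_join A B <= D) = (A <= D) && (B <= D).
Proof. by rewrite !closed_leE subsetI. Qed.

HB.instance Definition _ := Order.POrder_isMeetSemilattice.Build
  closed_sets_display (closed_sets C) closed_lexI.
HB.instance Definition _ := Order.POrder_isJoinSemilattice.Build
  closed_sets_display (closed_sets C) closed_leUx.

Definition closed_bottom : closed_sets C := Sub _ (closed_setT C).
Definition closed_top : closed_sets C := Sub _ (closure_closed set0).

Fact closed_le0x A : closed_bottom <= A. Proof. exact: subsetT. Qed.
Fact closed_lex1 A : A <= closed_top.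
Proof. by rewrite closed_leE closure_min ?sub0set // (valP A). Qed.

HB.instance Definition _ := Order.hasBottom.Build
  closed_sets_display (closed_sets C) closed_le0x.
HB.instance Definition _ := Order.hasTop.Build
  closed_sets_display (closed_sets C) closed_lex1.

End ClosedSets.

(** * The star lattice of a graph of girth at least five *)

(** Irreflexivity is the case [x = y = z] of the absence of triangles. *)
Record girth5_graph (V : finType) := Girth5Graph {
  adj :> rel V;
  adj_sym : symmetric adj;
  adj_no_triangle : forall x y z, adj x y -> adj y z -> adj z x = false;
  adj_no_square : forall x x' y y', x != x' ->
    adj x y -> adj x' y -> adj x y' -> adj x' y' -> y = y'
}.

Section Stars.
Context {V : finType} (G : girth5_graph V).
Implicit Types (x y z v : V) (A : {set V}).

Lemma adj_neq x y : G x y -> x != y.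
Proof.
move=> xy; apply/eqP => E; move: xy; rewrite E => yy.
by move: (adj_no_triangle yy yy); rewrite yy.
Qed.

Definition centered x A := (x \in A) && (A \subset x |: [set y | G x y]).
Definition star A := [exists x, centered x A].
Definition star_closed A := [|| A == set0, A == setT | star A].

Lemma star1 x : star [set x].
Proof. by apply/existsP; exists x; rewrite /centered set11 sub1set setU11. Qed.

Lemma star2 x y : G x y -> star [set x; y].
Proof.
move=> xy; apply/existsP; exists x; rewrite /centered set21.
by rewrite setUS // sub1set inE.
Qed.

Lemma star3 x y z : G x y -> G x z -> star [set x; y; z].
Proof.
move=> xy xz; apply/existsP; exists x; rewrite /centered !inE eqxx /=.
by rewrite -setUA setUS // subUset !sub1set !inE xy.
Qed.

Lemma star_neq0 A : star A -> A != set0.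
Proof. by case/existsP => x /andP[xA _]; apply/set0Pn; exists x. Qed.

(** If the centre of one star lies in the other star, then it is also a centre
    of the intersection.  Otherwise the intersection consists of common
    neighbours of the two centres, and there is at most one of these. *)
Lemma star_closedI A B : star_closed A -> star_closed B -> star_closed (A :&: B).
Proof.
have small (D : {set V}) : (#|D| <= 1)%N -> star_closed D.
  rewrite leq_eqVlt ltnS leqn0 cards_eq0 => /orP[/cards1P[x ->]|/eqP ->].
    by rewrite /star_closed star1 !orbT.
  by rewrite /star_closed eqxx.
have sub (D : {set V}) x : x \in D -> D \subset x |: [set y | G x y] -> star_closed D.
  by move=> xD sD; apply/or3P/Or33/existsP; exists x; rewrite /centered xD.
case/or3P => [/eqP -> _|/eqP -> //|/existsP[x /andP[xA sA]]].
- by rewrite set0I /star_closed eqxx.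
- by rewrite setTI.
case/or3P => [/eqP ->|/eqP ->|/existsP[y /andP[yB sB]]].
- by rewrite setI0 /star_closed eqxx.
- by rewrite setIT; apply: sub xA sA.
have [xB|xNB] := boolP (x \in B).
  by apply: (sub _ x); rewrite ?inE ?xA // (subset_trans (subsetIl _ _)).
have [yA|yNA] := boolP (y \in A).
  by apply: (sub _ y); rewrite ?inE ?yA // (subset_trans (subsetIr _ _)).
apply/small/card_le1_eqP => u v.
have common w : w \in A :&: B -> G x w && G y w.
  rewrite inE => /andP[wA wB].
  have /setU1P[wx|] := subsetP sA _ wA; first by rewrite -wx wB in xNB.
  have /setU1P[wy|] := subsetP sB _ wB; first by rewrite -wy wA in yNA.
  by rewrite !inE => -> ->.
move=> /common/andP[xu yu] /common/andP[xv yv].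
have xy : x != y by apply: contraNneq xNB => ->.
exact: (adj_no_square xy xv yv xu yu).
Qed.

Lemma star_closedT : star_closed setT.
Proof. by rewrite /star_closed eqxx orbT. Qed.

Definition star_system : closure_system V :=
  ClosureSystem star_closedT star_closedI.

Definition star_lattice : finTBLatticeType closed_sets_display :=
  closed_sets star_system.

Implicit Types (X Y : star_lattice).

(** A set that is not closed is sent to the top. *)
Definition flat A : star_lattice := insubd (\top : closed_sets star_system) A.

Lemma star_leE X Y : (X <= Y) = (val Y \subset val X). Proof. by []. Qed.

Lemma val_flat A : star A -> val (flat A) = A.
Proof. by move=> sA; rewrite val_insubd /= /star_closed sA !orbT. Qed.

Lemma flatK X : flat (val X) = X. Proof. exact: valKd. Qed.

Lemma val_top : val (\top : star_lattice) = set0.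
Proof.
have Z0 : star_system set0 by rewrite /= /star_closed eqxx.
by apply/eqP; rewrite -subset0; apply: (lex1 (Sub set0 Z0 : star_lattice)).
Qed.

Lemma top_val X : (X == \top) = (val X == set0).
Proof. by rewrite -val_top (inj_eq val_inj). Qed.

Lemma flat_neq_top A : star A -> flat A != \top.
Proof. by move=> sA; rewrite top_val val_flat // star_neq0. Qed.

Definition vertex x := flat [set x].
Definition edge x y := flat [set x; y].
(** The path with middle vertex [x] and ends [y] and [z]. *)
Definition path3 x y z := flat [set x; y; z].

Lemma sub_star X Y : star (val X) -> X <= Y -> Y != \top -> star (val Y).
Proof.
move=> sX; rewrite star_leE top_val => sYX YN0.
case/or3P: (valP Y) => // /eqP E; move: YN0 sYX; rewrite E ?eqxx //.
by rewrite subTset => _ /eqP <-.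
Qed.

Lemma star_card2 A : star A -> #|A| == 2 -> exists x y, G x y /\ A = [set x; y].
Proof.
move=> sA /cards2P[p [q [pq Apq]]]; exists p, q; split=> //.
case/existsP: sA => w; rewrite /centered Apq !inE => /andP[].
rewrite subUset !sub1set !inE (eq_sym p w) (eq_sym q w).
case/orP => /eqP -> /andP[]; rewrite eqxx ?orbT /=.
  by move=> _; rewrite (negPf pq).
by rewrite (eq_sym q) (negPf pq) /= adj_sym.
Qed.

Lemma card_vertices A : star A ->
  #|[set Y : star_lattice | (val Y \subset A) && (#|val Y| == 1)]| = #|A|.
Proof.
move=> sA; rewrite -[RHS](card_imset _ (_ : injective vertex)); last first.
  by move=> x y /(congr1 val); rewrite !val_flat ?star1 // => /set1_inj.
congr #|pred_of_set _|; apply/setP => Y; rewrite inE; apply/idP/imsetP.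
  case/andP => sYA /cards1P[x Yx]; exists x; first by rewrite -sub1set -Yx.
  by rewrite /vertex -Yx flatK.
by case=> x xA ->; rewrite val_flat ?star1 // sub1set xA cards1.
Qed.

Lemma card_edges A : star A ->
  #|[set Y : star_lattice | (val Y \subset A) && (#|val Y| == 2)]| = #|A|.-1.
Proof.
case/existsP => x /andP[xA sA].
have adjA y : y \in A :\ x -> G x y.
  by case/setD1P => yx /(subsetP sA); rewrite !inE (negPf yx).
rewrite (cardsD1 x A) xA /= -[RHS](card_in_imset (f := edge x)); last first.
  move=> y z yA zA /(congr1 val); rewrite !val_flat ?star2 ?adjA // => E.
  have := set22 x y; rewrite E !inE; case/setD1P: yA => /negPf -> _.
  by move/eqP.
congr #|pred_of_set _|; apply/setP => Y; rewrite inE; apply/idP/imsetP.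
  case/andP => sYA Y2.
  have sY : star (val Y).
    have sA' : star A by apply/existsP; exists x; rewrite /centered xA.
    apply: (@sub_star (flat A)); rewrite ?star_leE ?val_flat //.
    by rewrite top_val -cards_eq0 (eqP Y2).
  have [p [q [Gpq Ypq]]] := star_card2 sY Y2; have pq := adj_neq Gpq.
  have [pA qA] : p \in A /\ q \in A.
    by move: sYA; rewrite Ypq subUset !sub1set => /andP[].
  have [px|px] := eqVneq p x.
    by exists q; rewrite ?inE /edge -?px -?Ypq ?flatK // qA eq_sym pq.
  have [qx|qx] := eqVneq q x.
    by exists p; rewrite ?inE /edge -?qx 1?setUC -?Ypq ?flatK // pA pq.
  have Gxp : G x p by apply: adjA; rewrite !inE px.
  have Gxq : G x q by apply: adjA; rewrite !inE qx.
  by move: Gxq; rewrite adj_sym (adj_no_triangle Gxp Gpq).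
case=> y yA ->; rewrite val_flat ?star2 ?adjA // subUset !sub1set xA.
by case/setD1P: yA => yx yA; rewrite yA cards2 (eq_sym x) yx.
Qed.

(** The closed form of the Moebius function, read on the number of elements of a
    star; the value at 0 is the one at the top element. *)
Definition star_mobius A : int :=
  ((#|A| == 0)%:R - (#|A| == 1)%:R + (#|A| == 2)%:R)%R.

(** A star is a tree, with one edge less than it has vertices. *)
Lemma star_mobius_sum X : star (val X) ->
  (\sum_(Y : star_lattice | (X <= Y)%O) star_mobius (val Y) = 0)%R.
Proof.
move=> sX; rewrite big_split /= sumrB.
pose level k := [set Y : star_lattice | (val Y \subset val X) && (#|val Y| == k)].
have count (k : nat) :
    (\sum_(Y : star_lattice | (X <= Y)%O) (#|val Y| == k)%:R = #|level k|%:R :> int)%R.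
  rewrite -sum1_card natr_sum big_mkcond [RHS]big_mkcond; apply: eq_bigr => Y _.
  by rewrite inE star_leE; case: (_ \subset _) => //; case: eqP.
rewrite !count card_vertices // card_edges //.
have -> : level 0 = [set \top].
  apply/setP => Y; rewrite !inE cards_eq0 -top_val andb_idl // => /eqP ->.
  by rewrite val_top sub0set.
have: (0 < #|val X|)%N by rewrite card_gt0 star_neq0.
rewrite cards1; case: #|_| => // n _; rewrite /= -[n.+1]addn1 natrD opprD.
by rewrite addrCA subrr addr0 addNr.
Qed.

Lemma mobius_star X : star (val X) -> mobius X = star_mobius (val X).
Proof.
have [n le_n] := ubnP #|val X|; elim: n X le_n => // n IHn X le_n sX.
have XNtop : X != \top by rewrite top_val star_neq0.
rewrite mobius_lt_top //; have := star_mobius_sum sX.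
rewrite (bigD1 X) //= => /eqP; rewrite addr_eq0 => /eqP ->; congr (- _)%R.
apply: eq_big => [Y|Y XY]; first by rewrite lt_neqAle andbC eq_sym.
have [->|YNtop] := eqVneq Y \top.
  by rewrite mobius_top val_top /star_mobius cards0.
have XleY : X <= Y by exact: ltW XY.
apply: IHn; last exact: sub_star sX XleY YNtop.
rewrite -ltnS (leq_trans _ le_n) // ltnS.
exact: proper_card XY.
Qed.

(** The exclusion of stars in the last case makes the bottom element lie
    strictly below all vertices, edges and paths: playing it does not affect
    them. *)
Lemma move_cases X : X != \top -> mobius X != 0%R ->
  [\/ exists x, X = vertex x,
      exists x y, G x y /\ X = edge x y |
      val X = setT /\ ~~ star setT].
Proof.
move=> XNtop muX.
have moves : star (val X) -> [\/ exists x, X = vertex x,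
      exists x y, G x y /\ X = edge x y |
      val X = setT /\ ~~ star setT].
  move=> sX; move: muX; rewrite mobius_star // /star_mobius cards_eq0 -top_val.
  rewrite (negPf XNtop); have [/cards1P[x Xx] _|_] := boolP (#|val X| == 1).
    by apply: Or31; exists x; rewrite /vertex -Xx flatK.
  have [X2 _|_] := boolP (#|val X| == 2); last by rewrite subrr eqxx.
  apply: Or32; have [x [y [Gxy Xxy]]] := star_card2 sX X2.
  by exists x, y; rewrite /edge -Xxy flatK.
case/or3P: (valP X) => [|/eqP XT|sX].
- by rewrite -top_val (negPf XNtop).
- case/orP: (orbN (star setT)) => [sT|sNT]; last by apply: Or33.
  by apply: moves; rewrite XT.
- exact: moves.
Qed.

(** * Deviations *)

Definition on (s : seq star_lattice) x := toggle_parity s (vertex x).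
(** [x] deviates towards [y]: the edge [xy] and the vertex [x] differ. *)
Definition dev (s : seq star_lattice) x y :=
  toggle_parity s (edge x y) (+) on s x.

(** A vertex or an edge inside the path [y - x - z] lies inside [xy] or inside
    [xz], and inside both only if it is the vertex [x].  Absence of triangles
    matters here: [yz] is not an edge. *)
Lemma parity_path3 (s : seq star_lattice) x y z :
  G x y -> G x z -> y != z -> toggle_sequence s ->
  toggle_parity s (path3 x y z) =
    toggle_parity s (edge x y) (+) toggle_parity s (edge x z) (+) on s x.
Proof.
move=> xy xz yz; elim=> [|{}s w _ IHs wNtop mu_w _]; first by [].
rewrite /on !toggle_parity_rcons IHs /on.
suff -> : (path3 x y z <= w) =
    (edge x y <= w) (+) (edge x z <= w) (+) (vertex x <= w).
  by do 3 case: (toggle_parity _ _); do 3 case: (_ <= _).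
rewrite !star_leE !val_flat ?star1 ?star2 ?star3 //.
have [xNy xNz] := (adj_neq xy, adj_neq xz).
case: (move_cases wNtop mu_w) => [[v ->]|[u [v [uv ->]]]|[-> sNT]].
- rewrite val_flat ?star1 // !sub1set !inE.
  case: (eqVneq v x) => [->|vx]; first by rewrite (negPf xNy) (negPf xNz).
  case: (eqVneq v y) => [->|vy]; first by rewrite (negPf yz).
  by rewrite addbF.
- have uNv := adj_neq uv; rewrite val_flat ?star2 // !subUset !sub1set !inE.
  have yzN : G y z = false by apply: (adj_no_triangle _ xy); rewrite adj_sym.
  case: (eqVneq u x) uv uNv => [-> _|ux].
    rewrite (negPf xNy) (negPf xNz) /= eq_sym => /negPf -> /=.
    by case: (eqVneq v y) => [->|_]; rewrite ?(negPf yz) //= addbF.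
  case: (eqVneq u y) => [->|uy].
    rewrite (negPf yz) /= eq_sym => yv /negPf ->.
    have -> : v == z = false by apply: contraFF yzN => /eqP <-.
    by rewrite !orbF !addbF.
  case: (eqVneq u z) => [->|uz] //=; rewrite eq_sym => zv /negPf ->.
  have -> : v == y = false by apply: contraFF yzN => /eqP <-; rewrite adj_sym.
  by rewrite !orbF addbF.
- rewrite !subTset.
  by do 4 (case: eqP => [E|_]; first by rewrite -E ?star1 ?star2 ?star3 in sNT).
Qed.

(** Deviations start and end only at moves [w] above [xy] but not above [x].
    Such a [w] is also above every path [y - x - z], so before the move the path,
    the edge [xy] and [w] have the same parity; by [parity_path3], [x] does not
    deviate towards [z], and the move does not change that. *)
Lemma dev_unique (s : seq star_lattice) x y z :
  toggle_sequence s -> G x y -> G x z -> dev s x y -> dev s x z -> y = z.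
Proof.
move=> sP; elim: sP x y z => [|{}s w sP IHs wNtop mu_w w_unif] x y z; first by [].
have flip v t : dev (rcons s w) v t =
    dev s v t (+) ((edge v t <= w) (+) (vertex v <= w)).
  by rewrite /dev /on !toggle_parity_rcons addbACA.
have stable u v t : G u v -> G u t -> v != t ->
    (edge u v <= w) (+) (vertex u <= w) -> dev (rcons s w) u t = false.
  move=> uv ut vt; have le_vu : vertex u <= w -> edge u v <= w.
    rewrite !star_leE !val_flat ?star1 ?star2 // => sw.
    by apply: subset_trans sw (subsetUl _ _).
  case uw: (vertex u <= w); first by rewrite le_vu.
  rewrite addbF flip => uvw.
  have wuv : toggle_parity s (edge u v) = toggle_parity s w.
    have [->//|uvNw] := eqVneq (edge u v) w.
    by apply: w_unif; rewrite lt_neqAle uvNw.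
  have path_lt : path3 u v t <= edge u v.
    by rewrite star_leE !val_flat ?star2 ?star3 // subsetUl.
  have wp : toggle_parity s (path3 u v t) = toggle_parity s w.
    have [->//|pNw] := eqVneq (path3 u v t) w; apply: w_unif.
    by rewrite lt_neqAle pNw (le_trans path_lt).
  (* a nonempty set inside both [uv] and [ut] is the vertex [u] *)
  have -> : edge u t <= w = false.
    apply: contraFF uw; move: uvw; rewrite !star_leE !val_flat ?star1 ?star2 //.
    move=> /subsetP uvw /subsetP utw; apply/subsetP => q qw.
    move: (uvw _ qw) (utw _ qw); rewrite !inE; case: eqP => //= _ /eqP ->.
    by rewrite (negPf vt).
  rewrite uw addbF.
  move: wp; rewrite parity_path3 // -wuv /dev.
  by do 2 case: (toggle_parity _ _); case: (on _ _).
move=> xy xz; have [//|yz] := eqVneq y z.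
case fy: ((edge x y <= w) (+) (vertex x <= w)).
  by rewrite (stable x y z).
case fz: ((edge x z <= w) (+) (vertex x <= w)).
  by rewrite (stable x z y) // eq_sym.
by rewrite !flip fy fz !addbF; apply: IHs.
Qed.

(** * Edge boundaries *)

Definition cut (U : {set V}) : {set V * V} :=
  [set p | [&& G p.1 p.2, p.1 \in U & p.2 \notin U]].

Lemma devC (s : seq star_lattice) x y :
  dev s x y (+) dev s y x = on s x (+) on s y.
Proof.
rewrite /dev /edge (setUC [set y]).
by case: (toggle_parity _ _); do 2 case: (on _ _).
Qed.

(** Across an edge of the boundary exactly one end deviates towards the other
    by [devC]; charging the edge to that end is injective by [dev_unique]. *)
Lemma toggle_cut (s : seq star_lattice) :
  toggle_sequence s -> (#|cut [set x | on s x]| <= #|V|)%N.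
Proof.
move=> sP; pose source p := if dev s p.1 p.2 then p.1 else p.2.
rewrite -(card_in_imset (f := source)) ?max_card // => -[x y] [x' y'].
rewrite !inE /= => /and3P[xy ux uNy] /and3P[xy' ux' uNy'].
rewrite /source /=; have := devC s x' y'; have := devC s x y.
rewrite ux ux' (negPf uNy) (negPf uNy') /=.
case xDy: (dev s x y); case xDy': (dev s x' y') => /= yDx yDx' E.
- by rewrite E in xy xDy *; rewrite (dev_unique sP xy xy').
- by rewrite E (negPf uNy') in ux.
- by rewrite E ux' in uNy.
- rewrite E in xy yDx *.
  by rewrite (dev_unique (x := y') (y := x) (z := x') sP) // adj_sym.
Qed.

Lemma on_rcons (s : seq star_lattice) w x :
  w != \top -> on (rcons s w) x = on s x (+) (w == vertex x).
Proof.
move=> wNtop; rewrite /on toggle_parity_rcons star_leE val_flat ?star1 //.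
rewrite subset1 -top_val (negPf wNtop) orbF; congr (_ (+) _).
by rewrite -[RHS](inj_eq val_inj) val_flat ?star1.
Qed.

(** The number of vertices of [S] that are on starts at 0, moves by at most one
    at a time, and can never be [k], where [toggle_cut] would fail; so it stays
    below [k] and never reaches the size of [S]. *)
Lemma wide_cut_unwinnable (S : {set V}) (k : nat) :
  (k <= #|S|)%N -> (forall U, #|U :&: S| = k -> (#|V| < #|cut U|)%N) ->
  ~ toggle_game_can_be_won star_lattice.
Proof.
move=> le_kS wide [s [sP sT]].
have few (t : seq star_lattice) : toggle_sequence t -> (#|[set x | on t x] :&: S| < k)%N.
  elim=> [|{}t w tP IHt wNtop mu_w w_unif].
    have -> : [set x | on [::] x] = set0 by apply/setP => x; rewrite !inE.
    rewrite set0I cards0 lt0n; apply/negP => /eqP k0.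
    have := wide set0; rewrite set0I cards0 k0 => /(_ erefl).
    have -> : cut set0 = set0 by apply/setP => p; rewrite !inE andbF.
    by rewrite cards0.
  have t'P : toggle_sequence (rcons t w) by apply: toggle_rcons.
  set U := [set x | on (rcons t w) x].
  have : (#|U :&: S| <= k)%N.
    apply: leq_trans IHt; rewrite -add1n.
    have sub :
        U :&: S \subset [set x | w == vertex x] :|: ([set x | on t x] :&: S).
      apply/subsetP => x; rewrite !inE on_rcons // => /andP[tx ->].
      by case: eqP tx => //= _; rewrite addbF andbT.
    apply: leq_trans (subset_leq_card sub) _.
    rewrite (leq_trans (leq_card_setU _ _)) // leq_add2r.
    apply/card_le1_eqP => x y; rewrite !inE => /eqP -> /eqP /(congr1 val).
    by rewrite !val_flat ?star1 // => /set1_inj.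
  rewrite leq_eqVlt => /orP[/eqP /wide|//].
  by rewrite ltnNge toggle_cut.
have := few s sP; suff -> : [set x | on s x] = setT by rewrite setTI ltnNge le_kS.
apply/setP => x; rewrite !inE /on.
by move/setP: sT => /(_ (vertex x)); rewrite !inE flat_neq_top ?star1.
Qed.

End Stars.

(** * Incidence graphs of affine planes *)

Section AffinePlane.
Context (F : finFieldType).
Local Open Scope ring_scope.

(** A line is given by its slope and its intercept.  Vertical lines are left
    out, so that points and lines are both pairs of field elements. *)
Definition on_line (p l : F * F) := p.2 == l.1 * p.1 + l.2.

Definition incident (x y : (F * F) + (F * F)) :=
  match x, y with
  | inl p, inr l | inr l, inl p => on_line p l
  | _, _ => false
  end.

Definition line_through (p p' : F * F) : F * F :=
  let m := (p'.2 - p.2) / (p'.1 - p.1) in (m, p.2 - m * p.1).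

Lemma line_throughl p p' : on_line p (line_through p p').
Proof. by rewrite /on_line addrC subrK. Qed.

Lemma line_throughr p p' : p.1 != p'.1 -> on_line p' (line_through p p').
Proof.
rewrite eq_sym -subr_eq0 => pNp'; rewrite /on_line /=.
by rewrite addrCA -mulrBr divfK // addrC subrK.
Qed.

Lemma on_line_inj p l p' : on_line p l -> on_line p' l -> p.1 = p'.1 -> p = p'.
Proof.
by case: p p' => [a b] [a' b'] /eqP /= -> /eqP /= -> ->.
Qed.

Lemma on_line_slope p p' l : on_line p l -> on_line p' l ->
  l.1 * (p.1 - p'.1) = p.2 - p'.2.
Proof.
by move=> /eqP -> /eqP ->; rewrite mulrBr opprD addrACA subrr addr0.
Qed.

Lemma on_line2 p p' l l' : p != p' ->
  on_line p l -> on_line p' l -> on_line p l' -> on_line p' l' -> l = l'.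
Proof.
move=> pNp' pl p'l pl' p'l'.
have pp1 : p.1 - p'.1 != 0.
  by rewrite subr_eq0; apply: contra_neq pNp'; apply: on_line_inj pl p'l.
have eq_slope : l.1 = l'.1.
  by apply: (mulIf pp1); rewrite (on_line_slope pl) // (on_line_slope pl').
move: pl pl'; rewrite /on_line -eq_slope => /eqP -> /eqP /addrI eq_const.
by apply/eqP; rewrite [l]surjective_pairing [l']surjective_pairing eq_slope eq_const.
Qed.

Lemma incident_sym : symmetric incident. Proof. by case=> p [] l. Qed.

Lemma incident_no_triangle x y z : incident x y -> incident y z -> incident z x = false.
Proof. by case: x y z => ? [] ? [] ?. Qed.

Lemma incident_no_square x x' y y' : x != x' ->
  incident x y -> incident x' y -> incident x y' -> incident x' y' -> y = y'.
Proof.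
case: x x' y y' => [p|l] [p'|l'] [q|q] [q'|q'] //= xNx' xy x'y xy' x'y'.
  by congr inr; apply: on_line2 xy x'y xy' x'y'; apply: contra_neq xNx' => ->.
congr inl; apply/eqP; apply: contraTT isT => qNq'.
by case/negP: xNx'; rewrite (on_line2 qNq' xy xy' x'y x'y').
Qed.

Definition incidence_graph : girth5_graph ((F * F) + (F * F))%type :=
  Girth5Graph incident_sym incident_no_triangle incident_no_square.

Local Close Scope ring_scope.

(** Let [A] be the set of the points in [U], of size [a].  Take a point [p] in
    [A] and a point [p'] outside.  If they have the same abscissa, then the pair
    is determined by [p] and the ordinate of [p'].  Otherwise let [l] be the line
    through them: one of the edges [pl] and [lp'] belongs to the boundary of [U],
    according to whether [l] is in [U], and the pair is determined by this edge
    and the abscissa of the point that is not on it. *)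
Lemma incidence_cut (U : {set (F * F) + (F * F)}) (a : nat) :
  #|U :&: [set inl p | p : F * F]| = a ->
  (a * (#|F| ^ 2 - a) <= #|F| * (#|cut incidence_graph U| + a))%N.
Proof.
pose A := [set p | inl p \in U].
have -> : U :&: [set inl p | p : F * F] = inl @: A.
  apply/setP => -[p|l]; rewrite inE.
    by rewrite !(mem_imset _ _ (@inl_inj _ _)) !inE andbT.
  by apply/andP/imsetP => [[_ /imsetP[]]|[]].
rewrite card_imset => [<-|]; last exact: inl_inj.
pose C := cut incidence_graph U.
have card_AC : #|setX A (~: A)| = #|A| * (#|F| ^ 2 - #|A|).
  by rewrite cardsX [#|~: A|]cardsCs setCK card_prod mulnn.
pose vert := [set pq : (F * F) * (F * F) | pq.1.1 == pq.2.1].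
rewrite -card_AC -(cardsID vert (setX A (~: A))) addnC mulnDr leq_add //.
  pose vertexT := ((F * F) + (F * F))%type.
  pose f (pq : (F * F) * (F * F)) : F * (vertexT * vertexT) :=
    let l := line_through pq.1 pq.2 in
    if inr l \in U then (pq.1.1, (inr l, inl pq.2)) else (pq.2.1, (inl pq.1, inr l)).
  have -> : #|F| * #|C| = #|setX [set: F] C| by rewrite cardsX cardsT.
  rewrite -(card_in_imset (f := f)); last first.
    move=> [p p'] [q q']; rewrite !inE /=
      => /andP[pp1 /andP[pA p'A]] /andP[qq1 /andP[qA q'A]].
    rewrite /f /=; move: (line_throughl p p') (line_throughr pp1).
    move: (line_throughl q q') (line_throughr qq1).
    move: (line_through p p') (line_through q q') => l l' ql' q'l' pl p'l.
    case: ifP => _; case: ifP => _ // [E1 E2 E3].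
      by rewrite -E2 -E3 in ql' *; rewrite (on_line_inj pl ql' E1).
    by rewrite -E2 -E3 in q'l' *; rewrite (on_line_inj p'l q'l' E1).
  apply/subset_leq_card/subsetP => _ /imsetP[[p p'] pp' ->].
  move: pp'; rewrite !inE /= => /andP[pp1 /andP[pA p'A]].
  rewrite /f /=; case: ifP => lU /=; first by rewrite lU p'A line_throughr.
  by rewrite pA lU line_throughl.
pose g (pq : (F * F) * (F * F)) : F * (F * F) := (pq.2.2, pq.1).
have -> : #|F| * #|A| = #|setX [set: F] A| by rewrite cardsX cardsT.
rewrite -(card_in_imset (f := g)); last first.
  move=> [[p1 p2] [p1' p2']] [[q1 q2] [q1' q2']]; rewrite !inE /g /=.
  by move=> /andP[_ /eqP <-] /andP[_ /eqP <-] [-> -> ->].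
apply/subset_leq_card/subsetP => _ /imsetP[[p p'] pp' ->].
by move: pp'; rewrite !inE /= => /andP[/andP[]].
Qed.

Lemma incidence_unwinnable :
  #|F| = 11 -> ~ toggle_game_can_be_won (star_lattice incidence_graph).
Proof.
move=> cardF; have cardP : #|[set (inl p : F * F + F * F) | p : F * F]| = 121.
  by rewrite card_imset ?cardsT ?card_prod ?cardF //; apply: inl_inj.
(* About half of the 121 points: then the boundary has at least
   60 * 61 / 11 - 60 > 272 edges, while the graph has 242 vertices. *)
apply: (@wide_cut_unwinnable _ _ [set inl p | p : F * F] 60).
  by rewrite cardP.
move=> U /incidence_cut; rewrite cardF card_sum !card_prod cardF.
rewrite mulnDr addnC -leq_subLR => le_cut.
by rewrite -(ltn_pmul2l (_ : 0 < 11)%N) // (leq_trans _ le_cut).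
Qed.

End AffinePlane.

Theorem corollary7p4 :
  (exists (d : Order.disp_t) (P : finTBLatticeType d),
     ~ toggle_game_can_be_won P) /\
  ~ left_linear_NCI.
Proof.
have card11 : #|'F_11| = 11 by rewrite card_Fp.
have unwinnable := incidence_unwinnable card11.
split; first by exists _, (star_lattice (incidence_graph 'F_11)).
by move=> NCI; apply: unwinnable; apply: left_linear_NCI_winnable NCI.
Qed.
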